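(* Let $(A,+)$ be an abelian group, $\alpha,\beta\in A$, $n\ge 0$, and $M,N\in\mathcal{M}(n)$ (not necessarily distinct). 1. $s_{\alpha,\beta}(\mathcal{T}(M,l))=s_{\alpha,\beta}(\mathcal{T}(N,l))$ for all $l\ge 0$ if and only if $s_{\alpha,\beta}(M)=s_{\alpha,\beta}(N)$ and the sequences $seq_{\alpha,\beta}(M)$ and $seq_{\alpha,\beta}(N)$ are equal as multisets (ignoring order of terms). 2. $s_{\alpha,\beta}(\mathcal{T}(M,l))=s_{\beta,\alpha}(\mathcal{T}(N,l))$ for all $l\ge 0$ if and only if $s_{\alpha,\beta}(M)=s_{\beta,\alpha}(N)$ and the sequences $seq_{\alpha,\beta}(M)$ and $seq_{\beta,\alpha}(N)$ are equal as multisets.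
   Context: A matching on $[2n]$ is a partition of $[2n]$ into $n$ two-element blocks (edges); $\mathcal{M}(n)$ is the set of such matchings, $\mathcal{M}(0)=\{\emptyset\}$. Edges $A,B$ cross if $\min A<\min B<\max A<\max B$ or vice versa, and are nested if $\min A<\min B<\max B<\max A$ or vice versa; $cr(M),ne(M)$ count crossing and nested pairs, and $s_{\alpha,\beta}(M)=cr(M)\alpha+ne(M)\beta$. A matching $M\in\mathcal{M}(m)$ has $2m+1$ gaps: gap 1 before the point 1, gap $j$ between points $j-1$ and $j$ for $2\le j\le 2m$, gap $2m+1$ after $2m$. For $M\in\mathcal{M}(m)$ and $1\le i\le 2m+1$, inserting into gap $i$ a new first edge produces the matching in $\mathcal{M}(m+1)$ obtained by relabeling the vertices of $M$ order-preservingly by $\{2,\dots,2m+2\}\setminus\{i+1\}$ and adding $\{1,i+1\}$; these are the children of $M$. $\mathcal{T}(M,0)=\{M\}$ and $\mathcal{T}(M,l+1)$ is the set of children of members of $\mathcal{T}(M,l)$. For $x_1\dots x_l\in A^l$ and $y\in A$, $x_1\dots x_l+y$ denotes $(x_1+y)\dots(x_l+y)$. For $1\le i\le l$ define $R_{\alpha,\beta,i}(x_1x_2\dots x_l)=x_i\,(x_1x_2\dots x_i+x_i-x_1+\alpha)\,(x_ix_{i+1}\dots x_l+x_i-x_1+\beta)$ (concatenation; length $l+2$). The sequence $seq_{\alpha,\beta}(N)\in A^{2m+1}$ for $N\in\mathcal{M}(m)$ is defined recursively: $seq_{\alpha,\beta}(\emptyset)=(0_A)$, and if $N$ is obtained from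 $M$ by inserting a new first edge into gap $i$ of $M$, then $seq_{\alpha,\beta}(N)=R_{\alpha,\beta,i}(seq_{\alpha,\beta}(M))$. For a statistic $f$ and a set $Z$, $f(Z)$ is the multiset of values on $Z$ with multiplicities. *)

(* Defs.v *)
From HB Require Import structures.
From mathcomp Require Import all_boot all_order all_algebra.

Set Implicit Arguments.
Unset Strict Implicit.
Unset Printing Implicit Defensive.

Import GRing.Theory.

(* Vertices, gaps and sequence terms are numbered from 0: the vertex, gap or  *)
(* term of index k here is the one of index k + 1 in the usual numbering.     *)

Definition is_matching n (P : {set {set 'I_n.*2}}) : bool :=
  partition P [set: 'I_n.*2] && [forall e in P, #|e| == 2].

Record matching n := Matching {
  edges :> {set {set 'I_n.*2}};
  edgesP : is_matching edges
}.

HB.instance Definition _ n := [isSub for @edges n].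
HB.instance Definition _ n := [Finite of matching n by <:].

Definition emin k (e : {set 'I_k}) : nat := \big[minn/k]_(v in e) v.
Definition emax k (e : {set 'I_k}) : nat := \max_(v in e) v.

Definition crossing k (e f : {set 'I_k}) : bool :=
     [&& emin e < emin f, emin f < emax e & emax e < emax f]
  || [&& emin f < emin e, emin e < emax f & emax f < emax e].

Definition nested k (e f : {set 'I_k}) : bool :=
     [&& emin e < emin f, emin f < emax f & emax f < emax e]
  || [&& emin f < emin e, emin e < emax e & emax e < emax f].

(* The pairs are unordered, whence the two-element sets [set e; f].           *)
Definition cr n (M : matching n) : nat :=
  #|[set [set e; f] | e in edges M, f in edges M & crossing e f]|.

Definition ne n (M : matching n) : nat :=
  #|[set [set e; f] | e in edges M, f in edges M & nested e f]|.

Definition stat (A : zmodType) (alpha beta : A) n (M : matching n) : A :=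
  (alpha *+ cr M + beta *+ ne M)%R.

(* The order-preserving bijection from the old vertices onto the complement   *)
(* of {0, i + 1}.                                                             *)
Definition relabel m (i : 'I_m.*2.+1) (v : 'I_m.*2) : 'I_m.+1.*2 :=
  lift ord0 (lift i v).

Definition first_edge m (i : 'I_m.*2.+1) : {set 'I_m.+1.*2} :=
  [set ord0; lift ord0 i].

Definition insert_edges m (M : matching m) (i : 'I_m.*2.+1) :
    {set {set 'I_m.+1.*2}} :=
  first_edge i |: [set relabel i @: (e : {set _}) | e in edges M].

Lemma relabel_inj m (i : 'I_m.*2.+1) : injective (relabel i).
Proof. by move=> u v /lift_inj /lift_inj. Qed.

Lemma relabel_setT m (i : 'I_m.*2.+1) :
  relabel i @: [set: 'I_m.*2] = [set: 'I_m.+1.*2] :\: first_edge i.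
Proof.
apply/setP=> v; rewrite !inE andbT negb_or; apply/imsetP/andP.
  case=> u _ ->; split; first by rewrite eq_sym neq_lift.
  by rewrite (inj_eq (@lift_inj _ _)) eq_sym neq_lift.
rewrite eq_sym => -[v0 vi]; have [w def_v _] := unlift_some v0.
move: vi; rewrite def_v (inj_eq (@lift_inj _ _)) eq_sym => iw.
by have [u def_w _] := unlift_some iw; exists u; rewrite ?inE // def_w.
Qed.

Lemma card_first_edge m (i : 'I_m.*2.+1) : #|first_edge i| = 2.
Proof. by rewrite cards2 neq_lift. Qed.

Lemma insert_subproof m (M : matching m) i : is_matching (insert_edges M i).
Proof.
have /andP[partM /forall_inP cardM] := edgesP M; apply/andP; split.
  have -> : [set: 'I_m.+1.*2] = first_edge i :|: relabel i @: [set: 'I_m.*2].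
    by rewrite relabel_setT setDE setTI setUCr.
  apply: partitionU1.
  - by rewrite (imset_partition _ _ (@relabel_inj m i)).
  - by rewrite -card_gt0 card_first_edge.
  - by rewrite relabel_setT -setI_eq0 setDE setTI setICr.
apply/forall_inP=> e /setU1P[-> | /imsetP[f Mf ->]].
  by rewrite card_first_edge.
by rewrite card_imset ?cardM //; apply: relabel_inj.
Qed.

Definition insert m (M : matching m) (i : 'I_m.*2.+1) : matching m.+1 :=
  Matching (insert_subproof M i).

Lemma first_edge_notin m (M : matching m) i :
  first_edge i \notin [set relabel i @: (e : {set _}) | e in edges M].
Proof.
apply/imsetP=> -[e _ eq_e]; have := set21 ord0 (lift ord0 i).
by rewrite -/(first_edge i) eq_e => /imsetP[u _ /eqP]; rewrite (negPf (neq_lift _ _)).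
Qed.

Lemma insert_inj m (M N : matching m) i j :
  insert M i = insert N j -> M = N /\ i = j.
Proof.
move=> eqMN; have eq_e : insert_edges M i = insert_edges N j by case: eqMN.
have /andP[/and3P[_ triv _] _] := insert_subproof M i.
have Fi : first_edge i \in insert_edges M i by apply: setU11.
have Fj : first_edge j \in insert_edges M i by rewrite eq_e; apply: setU11.
have F0 (k : 'I_m.*2.+1) : ord0 \in first_edge k by apply: set21.
have eqF : first_edge i = first_edge j.
  by rewrite -(def_pblock triv Fi (F0 i)) (def_pblock triv Fj (F0 j)).
have eq_ij : i = j.
  have := set22 ord0 (lift ord0 i); rewrite -/(first_edge i) eqF.
  by rewrite !inE eq_sym (negPf (neq_lift _ _)) => /eqP/lift_inj.
move: eq_e; rewrite -eq_ij => eq_e; split=> //.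
apply/val_inj/(imset_inj (imset_inj (@relabel_inj m i))).
rewrite -[LHS](setU1K (first_edge_notin M i)) -/(insert_edges M i) eq_e.
by rewrite [LHS](setU1K (first_edge_notin N i)).
Qed.

Lemma insert_surj m (N : matching m.+1) :
  exists M : matching m, exists i, insert M i = N.
Proof.
have /andP[partN /forall_inP cardN] := edgesP N.
have cov0 : ord0 \in cover (edges N) by rewrite (cover_partition partN) inE.
pose B := pblock (edges N) ord0.
have NB : B \in edges N by apply: pblock_mem.
have B0 : ord0 \in B by rewrite mem_pblock.
have [i defB] : exists i, B = first_edge i.
  have /cards2P[u [v [neq_uv def_B]]] := cardN B NB; rewrite def_B.
  have := B0; rewrite def_B !inE => /orP[] /eqP eq0.
    rewrite -eq0 in neq_uv *.
    by have [i -> _] := unlift_some neq_uv; exists i.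
  rewrite -eq0 eq_sym in neq_uv *.
  by have [i -> _] := unlift_some neq_uv; exists i; rewrite setUC.
have := partitionD1 partN NB; rewrite defB -relabel_setT => part'.
pose P := [set relabel i @^-1: (e : {set _}) | e in edges N :\ first_edge i].
have imK (e : {set _}) : e \in edges N :\ first_edge i ->
    relabel i @: (relabel i @^-1: e) = e.
  move=> Ne; have /subsetP sub := partitionS part' Ne.
  apply/setP=> v; apply/imsetP/idP=> [[u] | ve]; first by rewrite inE => ? ->.
  by have /imsetP[u _ def_v] := sub v ve; exists u; rewrite // inE -def_v.
have imP : [set relabel i @: (e : {set _}) | e in P] = edges N :\ first_edge i.
  by rewrite -imset_comp -[RHS]imset_id; apply: eq_in_imset => e /imK.
have matP : is_matching P.
  rewrite -imP (imset_partition _ _ (@relabel_inj m i)) in part'.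
  rewrite /is_matching part'; apply/forall_inP=> _ /imsetP[e Ne ->].
  rewrite -(card_imset _ (@relabel_inj m i)) imK //.
  by case/setD1P: Ne => _ /cardN.
exists (Matching matP), i; apply/val_inj => /=.
by rewrite /insert_edges /= imP setD1K -?defB.
Qed.

Definition children m (M : matching m) : {set matching m.+1} :=
  [set insert M i | i : 'I_m.*2.+1].

Fixpoint tree n (M : matching n) l : {set matching (l + n)} :=
  match l with
  | 0 => [set M]
  | l'.+1 => \bigcup_(M' in tree M l') children M'
  end.

Section SeqStat.

Variables (A : zmodType) (alpha beta : A).
Local Open Scope ring_scope.

Definition shift (s : seq A) (y : A) : seq A := [seq x + y | x <- s].

(* R_{alpha, beta, i + 1}(s).                                                 *)
Definition Rop (i : nat) (s : seq A) : seq A :=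
  s`_i :: shift (take i.+1 s) (s`_i - s`_0 + alpha)
       ++ shift (drop i s) (s`_i - s`_0 + beta).

(* By insert_inj and insert_surj there is exactly one pair p, so the default  *)
(* value is never reached; see seqstat_insert.                                *)
Fixpoint seqstat m : matching m -> seq A :=
  match m with
  | 0 => fun=> [:: 0]
  | m'.+1 => fun N =>
      if [pick p : matching m' * 'I_m'.*2.+1 | insert p.1 p.2 == N] is Some p
      then Rop p.2 (seqstat p.1) else [::]
  end.

Lemma seqstat_insert m (M : matching m) i :
  seqstat (insert M i) = Rop i (seqstat M).
Proof.
rewrite /=; case: pickP => [[N j] /= /eqP/insert_inj[-> ->] // | no_p].
by have:= no_p (M, i); rewrite /= eqxx.
Qed.

End SeqStat.

(* f(Z) as a list of values; multisets are compared with perm_eq.             *)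
Definition values (A : zmodType) (T : finType) (f : T -> A) (Z : {set T}) :
    seq A :=
  [seq f x | x in Z].

(* Main.v *)
Require Import Defs.
From mathcomp Require Import all_boot all_order all_algebra zify.

Set Implicit Arguments.
Unset Strict Implicit.
Unset Printing Implicit Defensive.

Import GRing.Theory.

(* The term of index j of seq(M) is the statistic of the matching obtained by *)
(* inserting a new first edge into gap j, so the levels l = 0 and l = 1 give  *)
(* the forward implications.  For the converse, put y_j = x_j - x_0 with      *)
(* x = seq(M), and let h_r(y) be the multiset of all sums of r terms of y     *)
(* with repetition.  A child of M has relative sequence 0,                    *)
(* (y_0 .. y_i) + alpha, (y_i .. y_2m) + beta, hence an element of h_r of the *)
(* child, with i varying, amounts to a sum of t + 1 terms of y (t <= r) in    *)
(* which the term of rank a plays the role of i, shifted by                   *)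
(* a alpha + (t - a) beta.  The union over i is thus expressed by the         *)
(* h_(t+1)(y) alone, which ignore the order of y, and symmetrically in alpha  *)
(* and beta; induction on l follows.                                          *)

(** The values at one level of the tree do not determine those at the next, so the induction on [l]
    carries the stronger family [treesum]: at each matching of level [l], its statistic plus all
    sums of [r] terms of its relative sequence; [r = 0] gives back the values. By [treesumS], level
    [l + 1] with [r] terms reduces to level [l] with at most [r + 1] terms, up to shifts independent
    of the matching. At level 0 only the statistic and, by [perm_hsum], the multiset of terms
    remain. The order of the terms disappears in [sum_hsum_rel_child]; the second part holds because
    this formula is symmetric in the weights ([treesum_swap]). The combinatorial input is
    [nth_seqstat], obtained from [cr_insert] and [ne_insert]. *)

Section CompleteSums.

Variable A : zmodType.
Implicit Types (s u v : seq A) (f g : A -> nat).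

(* The sum of f (x_1 + ... + x_r) over the multisets {x_1, ..., x_r} of       *)
(* positions of s.                                                            *)
Fixpoint hsum (r : nat) : seq A -> (A -> nat) -> nat :=
  if r is r'.+1 then
    fix hsumS s f :=
      if s is x :: s' then hsum r' s (fun z => f (x + z)%R) + hsumS s' f else 0
  else fun _ f => f 0%R.

Lemma hsum_cons r x s f :
  hsum r.+1 (x :: s) f = hsum r (x :: s) (fun z => f (x + z)%R) + hsum r.+1 s f.
Proof. by []. Qed.

Lemma eq_hsum r s f g : f =1 g -> hsum r s f = hsum r s g.
Proof.
elim: r s f g => [|r IHr] s f g eq_fg; first exact: eq_fg.
elim: s => //= x s ->; congr (_ + _); apply: IHr => z; exact: eq_fg.
Qed.

Lemma hsum_swap r x y s f : hsum r (x :: y :: s) f = hsum r (y :: x :: s) f.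
Proof.
elim/ltn_ind: r x y f => -[|[|r]] IHr x y f //; first by rewrite /= addnCA.
(* Multisets are sorted by their use of [a] and [b]: both, [a] only, [b] only, neither. *)
have step a b g : hsum r.+2 (a :: b :: s) g =
    hsum r (b :: a :: s) (fun z => g (a + (b + z))%R)
    + hsum r.+1 (a :: s) (fun z => g (a + z)%R)
    + (hsum r.+1 (b :: s) (fun z => g (b + z)%R) + hsum r.+2 s g).
  by rewrite hsum_cons IHr // !hsum_cons.
rewrite !step IHr // -addnA -[RHS]addnA; congr (_ + _); last exact: addnCA.
by apply: eq_hsum => z; rewrite addrCA.
Qed.

Lemma eq_hsum_cons x s t :
    (forall r f, hsum r s f = hsum r t f) ->
  forall r f, hsum r (x :: s) f = hsum r (x :: t) f.
Proof. by move=> eq_st; elim=> // r IHr f; rewrite !hsum_cons IHr eq_st. Qed.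

Lemma hsum_middle x s t r f : hsum r (s ++ x :: t) f = hsum r (x :: s ++ t) f.
Proof.
elim: s r f => //= y s IHs r f.
by rewrite hsum_swap; apply: eq_hsum_cons.
Qed.

Lemma perm_hsum r s t f : perm_eq s t -> hsum r s f = hsum r t f.
Proof.
elim: s t r f => [|x s IHs] t r f eq_st.
  by rewrite perm_sym in eq_st; rewrite (perm_nilP eq_st).
have /splitPr t_x : x \in t by rewrite -(perm_mem eq_st) mem_head.
case: t_x eq_st => t1 t2.
rewrite perm_sym perm_catC /= perm_cons perm_catC perm_sym => eq_st.
by rewrite hsum_middle; apply: eq_hsum_cons => *; apply: IHs.
Qed.

Lemma hsum_cons0 r s f : hsum r (0%R :: s) f = \sum_(t < r.+1) hsum t s f.
Proof.
elim: r f => [|r IHr] f; first by rewrite big_ord1.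
rewrite hsum_cons big_ord_recr -IHr; congr (_ + _).
by apply: eq_hsum => z; rewrite add0r.
Qed.

Lemma hsum_cat r u v f :
  hsum r (u ++ v) f =
  \sum_(a < r.+1) hsum a u (fun p => hsum (r - a) v (fun q => f (p + q)%R)).
Proof.
elim: r u f => [|r IHr] u f; first by rewrite big_ord1 /= addr0.
have nil_case : hsum r.+1 v f = hsum r.+1 v (fun q => f (0 + q)%R).
  by apply: eq_hsum => q; rewrite add0r.
elim: u => [|x u IHu].
  by rewrite big_ord_recl /= big1 ?addn0.
rewrite cat_cons hsum_cons -cat_cons IHr IHu.
rewrite [X in _ + X = _]big_ord_recl [in RHS]big_ord_recl addnCA; congr (_ + _).
rewrite -big_split; apply: eq_bigr => a _ /=.
rewrite /bump /= add1n subSS; congr (_ + _).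
by apply: eq_hsum => p; apply: eq_hsum => q; rewrite addrA.
Qed.

Lemma hsum_shift r s c f :
  hsum r (shift s c) f = hsum r s (fun z => f (z + c *+ r)%R).
Proof.
elim: r s f => [|r IHr] s f; first by rewrite /= addr0.
elim: s => // x s IHs; rewrite [shift _ _]/= !hsum_cons IHs; congr (_ + _).
rewrite -[_ :: _]/(shift (x :: s) c) IHr; apply: eq_hsum => z.
by rewrite mulrS -!addrA; congr (f (_ + _)%R); rewrite addrCA.
Qed.

(* A multiset of size a + b + 1 has a unique element of rank a; the factors   *)
(* range over the a elements below it and the b elements above it.            *)
Lemma sum_hsum_take_drop a b s f :
  \sum_(i < size s)
     hsum a (take i.+1 s) (fun p =>
       hsum b (drop i s) (fun q => f (s`_i + (p + q))%R)) =
  hsum (a + b).+1 s f.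
Proof.
elim: s a f => [|x s IHs] a f; first by rewrite big_ord0.
elim: a f => [|a IHa] f.
  rewrite hsum_cons big_ord_recl -IHs /=; congr (_ + _).
  by apply: eq_hsum => q; rewrite add0r.
(* A multiset containing [x] loses one copy of it, which lowers the rank of the pivot by one
   ([IHa]); the others live in [s] ([IHs]). *)
rewrite addSn hsum_cons -IHa -addSn -IHs !big_ord_recl /= take0 addn0.
rewrite -addnA; congr (_ + _).
  apply: eq_hsum => p; apply: eq_hsum => q; congr f.
  by rewrite -!addrA.
rewrite -big_split; apply: eq_bigr => i _ /=; congr (_ + _).
apply: eq_hsum => p; apply: eq_hsum => q; congr f.
by rewrite -(addrA x) [LHS]addrCA.
Qed.

(** This is [Rop] read relative to the statistic of the matching; see [relseq_insert]. *)
Definition rel_child alpha beta i s : seq A :=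
  0%R :: shift (take i.+1 s) alpha ++ shift (drop i s) beta.

Lemma sum_hsum_rel_child alpha beta r s f :
  \sum_(i < size s)
     hsum r (rel_child alpha beta i s) (fun z => f (s`_i + z)%R) =
  \sum_(t < r.+1) \sum_(a < t.+1)
     hsum t.+1 s (fun z => f (z + (alpha *+ a + beta *+ (t - a)))%R).
Proof.
under eq_bigr do rewrite hsum_cons0.
rewrite exchange_big; apply: eq_bigr => t _.
under eq_bigr do rewrite hsum_cat.
rewrite exchange_big; apply: eq_bigr => a _.
have def_t : a + (t - a) = t by rewrite subnKC ?leq_ord.
rewrite -[X in _ = hsum X.+1 s _]def_t -sum_hsum_take_drop.
apply: eq_bigr => i _; rewrite hsum_shift; apply: eq_hsum => p.
rewrite hsum_shift; apply: eq_hsum => q; congr f.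
by rewrite -[RHS]addrA [in RHS]addrACA.
Qed.

End CompleteSums.

(** * Counting unordered related pairs *)

Section Pairs.

Variable T : finType.
Implicit Types (r : rel T) (E : {set T}).

Definition pairs r E : {set {set T}} :=
  [set [set e; f] | e in E, f in E & r e f].

Lemma card_pairsU1 r x E :
    symmetric r -> irreflexive r -> x \notin E ->
  #|pairs r (x |: E)| = #|pairs r E| + \sum_(e in E) r x e.
Proof.
move=> r_sym r_irr xE.
have -> : \sum_(e in E) r x e = #|[set e in E | r x e]|.
  by rewrite -sum1dep_card big_mkcondr; apply: eq_bigr => e _; case: ifP.
have -> : pairs r (x |: E) =
    pairs r E :|: [set [set x; e] | e in [set e in E | r x e]].
  apply/setP=> P; apply/imset2P/setUP.
    case=> e f /setU1P[->|Ee]; rewrite inE => /andP[/setU1P[->|Ef] r_ef] ->.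
    - by rewrite r_irr in r_ef.
    - by right; apply/imsetP; exists f; rewrite ?inE ?Ef.
    - by right; apply/imsetP; exists e; rewrite ?inE ?Ee 1?r_sym // setUC.
    - by left; apply/imset2P; exists e f; rewrite ?inE ?Ef.
  case=> [/imset2P[e f Ee /[!inE]/andP[Ef r_ef] ->]|/imsetP[e]].
    by exists e f; rewrite ?inE ?Ee ?Ef ?r_ef ?orbT.
  by rewrite inE => /andP[Ee r_xe] ->; exists x e; rewrite ?inE ?eqxx ?Ee ?orbT.
rewrite cardsU; set I := _ :&: _; have -> : I = set0.
  apply/setP=> P; rewrite !inE; apply/negP.
  case/andP=> /imset2P[e f Ee /[!inE]/andP[Ef _] ->] /imsetP[g _ /setP/(_ x)].
  rewrite !inE eqxx /= => /orP[]/eqP xe.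
    by rewrite xe Ee in xE.
  by rewrite xe Ef in xE.
rewrite cards0 subn0 card_in_imset // => e f.
rewrite !inE => /andP[Ee _] /andP[Ef _] /setP/(_ e).
rewrite !inE eqxx orbT => /esym/orP[]/eqP // ex.
by rewrite -ex Ee in xE.
Qed.

End Pairs.

Lemma card_pairs_imset (T U : finType) (g : T -> U) (r : rel T) (r' : rel U)
    (E : {set T}) :
    injective g -> {in E &, forall e f, r' (g e) (g f) = r e f} ->
  #|pairs r' (g @: E)| = #|pairs r E|.
Proof.
move=> g_inj eq_r; rewrite -(card_imset _ (imset_inj g_inj)); congr #|pred_of_set _|.
apply/setP=> P; apply/imset2P/imsetP.
  case=> _ f' /imsetP[e Ee ->]; rewrite inE => /andP[/imsetP[f Ef ->]].
  rewrite eq_r // => r_ef ->; exists [set e; f]; last by rewrite imsetU1 imset_set1.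
  by apply/imset2P; exists e f; rewrite ?inE ?Ef.
case=> _ /imset2P[e f Ee /[!inE]/andP[Ef r_ef] ->] ->.
exists (g e) (g f); rewrite ?inE ?imset_f ?eq_r //.
by rewrite imsetU1 imset_set1.
Qed.

(** * Endpoints of edges *)

Section EdgeEndpoints.

Variable k : nat.
Implicit Types (e f : {set 'I_k}) (u v : 'I_k).

Lemma emin_pair u v : u < v -> emin [set u; v] = u.
Proof.
move=> lt_uv; apply/eqP; rewrite eqn_leq; apply/andP; split.
  (* [k] is not neutral for [minn] on all of [nat], so this bound is proved by induction on the
     enumeration. *)
  have: u \in index_enum 'I_k by apply: mem_index_enum.
  rewrite /emin; elim: (index_enum _) => //= w s IHs.
  rewrite inE big_cons => /predU1P[<-|/IHs le_u]; first by rewrite !inE eqxx geq_minl.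
  by case: ifP => // _; rewrite geq_min le_u orbT.
apply: (big_ind (leq u)) => [|p q|w]; [exact: ltnW | by rewrite leq_min => -> |].
by rewrite !inE => /orP[]/eqP-> //; apply: ltnW.
Qed.

Lemma emax_pair u v : u < v -> emax [set u; v] = v.
Proof.
move=> lt_uv; apply/eqP; rewrite eqn_leq; apply/andP; split.
  by apply/bigmax_leqP => w; rewrite !inE => /orP[]/eqP-> //; apply: ltnW.
by apply: (leq_bigmax_cond (F := fun w : 'I_k => w : nat)); rewrite !inE eqxx orbT.
Qed.

Lemma crossing_sym : symmetric (@crossing k).
Proof. by move=> e f; rewrite /crossing orbC. Qed.

Lemma crossing_irr : irreflexive (@crossing k).
Proof. by move=> e; rewrite /crossing ltnn. Qed.

Lemma nested_sym : symmetric (@nested k).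
Proof. by move=> e f; rewrite /nested orbC. Qed.

Lemma nested_irr : irreflexive (@nested k).
Proof. by move=> e; rewrite /nested ltnn. Qed.

End EdgeEndpoints.

Lemma edge_endpoints m (M : matching m) (e : {set 'I_m.*2}) :
  e \in edges M -> exists u v : 'I_m.*2, u < v /\ e = [set u; v].
Proof.
have /andP[_ /forall_inP cardM] := edgesP M.
move/cardM/cards2P => [u [v [neq_uv ->]]].
case: (ltngtP u v) => [lt_uv|lt_vu|eq_uv]; first by exists u, v.
  by exists v, u; rewrite setUC.
by rewrite (val_inj eq_uv) eqxx in neq_uv.
Qed.

Lemma emin_lt_emax m (M : matching m) (e : {set 'I_m.*2}) :
  e \in edges M -> emin e < emax e.
Proof.
by case/edge_endpoints=> u [v [lt_uv ->]]; rewrite emin_pair ?emax_pair.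
Qed.

(** * Effect of an insertion on crossings and nestings *)

Section Insertion.

Variables (m : nat) (M : matching m) (i : 'I_m.*2.+1).

Lemma val_relabel (v : 'I_m.*2) : relabel i v = (bump i v).+1 :> nat.
Proof. by []. Qed.

Lemma emin_relabel (e : {set 'I_m.*2}) :
  e \in edges M -> emin (relabel i @: e) = (bump i (emin e)).+1.
Proof.
case/edge_endpoints=> u [v [lt_uv ->]]; rewrite imsetU1 imset_set1.
by rewrite !emin_pair // !val_relabel ltnS ltnNge leq_bump2 -ltnNge.
Qed.

Lemma emax_relabel (e : {set 'I_m.*2}) :
  e \in edges M -> emax (relabel i @: e) = (bump i (emax e)).+1.
Proof.
case/edge_endpoints=> u [v [lt_uv ->]]; rewrite imsetU1 imset_set1.
by rewrite !emax_pair // !val_relabel ltnS ltnNge leq_bump2 -ltnNge.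
Qed.

Lemma emin_first_edge : emin (first_edge i) = 0.
Proof. by rewrite emin_pair. Qed.

Lemma emax_first_edge : emax (first_edge i) = i.+1.
Proof. by rewrite emax_pair. Qed.

Let ltn_bump2 a b : (bump i a < bump i b) = (a < b).
Proof. by rewrite !ltnNge leq_bump2. Qed.

Lemma crossing_relabel :
  {in edges M &, forall e f : {set 'I_m.*2},
     crossing (relabel i @: e) (relabel i @: f) = crossing e f}.
Proof.
move=> e f Me Mf; rewrite /crossing !emin_relabel // !emax_relabel //.
by rewrite !ltnS !ltn_bump2.
Qed.

Lemma nested_relabel :
  {in edges M &, forall e f : {set 'I_m.*2},
     nested (relabel i @: e) (relabel i @: f) = nested e f}.
Proof.
move=> e f Me Mf; rewrite /nested !emin_relabel // !emax_relabel //.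
by rewrite !ltnS !ltn_bump2.
Qed.

End Insertion.

(** Gap [j] has the vertices [0 .. j - 1] on its left, so these are the edges spanning the gap:
    those that a first edge ending there crosses. The edges counted by [nleft] are those it
    nests. *)
Definition ncover m (M : matching m) (j : nat) : nat :=
  \sum_(e in edges M) (emin e < j <= emax e).

Definition nleft m (M : matching m) (j : nat) : nat :=
  \sum_(e in edges M) (emax e < j).

Section InsertionStatistics.

Variables (m : nat) (M : matching m) (i : 'I_m.*2.+1).

Lemma sum_insert_edges (F : {set 'I_m.+1.*2} -> nat) :
  \sum_(e in edges (insert M i)) F e =
  F (first_edge i) + \sum_(e in edges M) F (relabel i @: (e : {set _})).
Proof.
rewrite /= big_setU1 ?first_edge_notin //= big_imset //.
by move=> e f _ _; apply: (imset_inj (@relabel_inj m i)).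
Qed.

Lemma cr_insert : cr (insert M i) = cr M + ncover M i.
Proof.
rewrite /cr -!/(pairs _ _) card_pairsU1 ?first_edge_notin //; first last.
- exact: crossing_irr.
- exact: crossing_sym.
rewrite (card_pairs_imset (imset_inj (@relabel_inj m i)) (@crossing_relabel m M i)).
congr (_ + _); rewrite big_imset /=; last first.
  by move=> e f _ _; apply: (imset_inj (@relabel_inj m i)).
apply: eq_bigr => e Me; have := emin_lt_emax Me.
rewrite /crossing (emin_relabel _ Me) (emax_relabel _ Me).
rewrite emin_first_edge emax_first_edge /bump; lia.
Qed.

Lemma ne_insert : ne (insert M i) = ne M + nleft M i.
Proof.
rewrite /ne -!/(pairs _ _) card_pairsU1 ?first_edge_notin //; first last.
- exact: nested_irr.
- exact: nested_sym.
rewrite (card_pairs_imset (imset_inj (@relabel_inj m i)) (@nested_relabel m M i)).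
congr (_ + _); rewrite big_imset /=; last first.
  by move=> e f _ _; apply: (imset_inj (@relabel_inj m i)).
apply: eq_bigr => e Me; have := emin_lt_emax Me.
rewrite /nested (emin_relabel _ Me) (emax_relabel _ Me).
rewrite emin_first_edge emax_first_edge /bump; lia.
Qed.

(** The old gap [i] is split by the new endpoint into gaps [i + 1] and [i + 2], so [k = i] is
    allowed both here and in [ncover_insert_right]; likewise [Rop] uses the term [i] in both
    blocks. *)
Lemma ncover_insert_inside k :
  k <= i -> ncover (insert M i) k.+1 = (ncover M k).+1.
Proof.
move=> le_ki; rewrite /ncover sum_insert_edges emin_first_edge emax_first_edge.
rewrite -[RHS]add1n; congr (_ + _); first lia.
apply: eq_bigr => e Me; rewrite (emin_relabel _ Me) (emax_relabel _ Me) /bump.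
lia.
Qed.

Lemma nleft_insert_inside k :
  k <= i -> nleft (insert M i) k.+1 = nleft M k.
Proof.
move=> le_ki; rewrite /nleft sum_insert_edges emax_first_edge.
rewrite -[RHS]add0n; congr (_ + _); first lia.
apply: eq_bigr => e Me; rewrite (emax_relabel _ Me) /bump; lia.
Qed.

Lemma ncover_insert_right k :
  i <= k -> ncover (insert M i) k.+2 = ncover M k.
Proof.
move=> le_ik; rewrite /ncover sum_insert_edges emin_first_edge emax_first_edge.
rewrite -[RHS]add0n; congr (_ + _); first lia.
apply: eq_bigr => e Me; rewrite (emin_relabel _ Me) (emax_relabel _ Me) /bump.
lia.
Qed.

Lemma nleft_insert_right k :
  i <= k -> nleft (insert M i) k.+2 = (nleft M k).+1.
Proof.
move=> le_ik; rewrite /nleft sum_insert_edges emax_first_edge.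
rewrite -[RHS]add1n; congr (_ + _); first lia.
apply: eq_bigr => e Me; rewrite (emax_relabel _ Me) /bump; lia.
Qed.

End InsertionStatistics.

Lemma ncover0 m (M : matching m) : ncover M 0 = 0.
Proof. by rewrite /ncover big1. Qed.

Lemma nleft0 m (M : matching m) : nleft M 0 = 0.
Proof. by rewrite /nleft big1. Qed.

(** * Closed form of the terms of the sequence *)

Section SeqstatValues.

Variables (A : zmodType) (alpha beta : A).
Local Open Scope ring_scope.

Lemma stat_insert m (M : matching m) i :
  stat alpha beta (insert M i) =
  stat alpha beta M + (alpha *+ ncover M i + beta *+ nleft M i).
Proof. by rewrite /stat cr_insert ne_insert !mulrnDr addrACA. Qed.

Lemma stat_empty (M : matching 0) : stat alpha beta M = 0.
Proof.
have M0 : edges M = set0.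
  apply/setP=> e; rewrite inE; apply/negP=> /edge_endpoints[u _].
  by case: u.
have pairs0 (r : rel {set 'I_0.*2}) : #|pairs r (edges M)| = 0%N.
  apply: eq_card0 => P; apply/imset2P=> -[e f Me _ _].
  by move: Me; rewrite M0 inE.
by rewrite /stat /cr /ne -!/(pairs _ _) !pairs0 addr0.
Qed.

Lemma size_seqstat m (M : matching m) : size (seqstat alpha beta M) = m.*2.+1.
Proof.
elim: m M => // m IHm N; have [M [i <-]] := insert_surj N.
rewrite seqstat_insert /= size_cat /shift !size_map size_take size_drop IHm.
have lt_i := ltn_ord i; case: ltnP; lia.
Qed.

Lemma nth_seqstat m (M : matching m) j :
    (j <= m.*2)%N ->
  (seqstat alpha beta M)`_j =
  stat alpha beta M + (alpha *+ ncover M j + beta *+ nleft M j).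
Proof.
elim: m M j => [|m IHm] N j le_j.
  rewrite leqn0 in le_j; rewrite (eqP le_j) stat_empty ncover0 nleft0.
  by rewrite !addr0.
have [M [i def_N]] := insert_surj N; rewrite -{N}def_N.
have le_i : (i <= m.*2)%N by rewrite -ltnS.
have size_s := size_seqstat M.
rewrite seqstat_insert /Rop; set s := seqstat _ _ M in size_s *.
have si : s`_i = stat alpha beta (insert M i) by rewrite IHm // stat_insert.
have s0 : s`_0 = stat alpha beta M by rewrite IHm // ncover0 nleft0 !addr0.
(* Here [x] and [z] are the statistics of parent and child: adding [s]_i - s[_0] rebases an old term
   to the child. *)
have alg (x y z c : A) : x + y + (z - x + c) = z + (y + c).
  by rewrite addrACA [x + (_ - _)]addrC subrK.
case: j le_j => [|j] le_j /=; first by rewrite si ncover0 nleft0 !addr0.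
rewrite nth_cat size_map size_takel ?size_s // ltnS.
case: leqP => [le_ji|lt_ij].
  rewrite (nth_map 0) ?size_takel ?size_s // nth_take // IHm ?(leq_trans le_ji) //.
  rewrite si s0 alg ncover_insert_inside // nleft_insert_inside //.
  by congr (_ + _); rewrite [in RHS]mulrSr [LHS]addrAC.
case: j le_j lt_ij => // j le_j lt_ij.
rewrite (nth_map 0) ?size_drop ?size_s; last lia.
rewrite nth_drop subSS subnKC // IHm; last lia.
rewrite si s0 alg ncover_insert_right // nleft_insert_right //.
by congr (_ + _); rewrite [in RHS]mulrSr [RHS]addrA.
Qed.

End SeqstatValues.

(** * Multisets of values as sums of test functions *)

Lemma perm_eq_sumP (T : eqType) (s t : seq T) :
  (forall f : T -> nat, \sum_(x <- s) f x = \sum_(x <- t) f x) <-> perm_eq s t.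
Proof.
split=> [eq_st | eq_st f]; last exact: perm_big.
apply/permP=> a; have := eq_st (fun x => a x : nat).
by rewrite -!big_mkcond !sum1_count.
Qed.

Lemma sum_values (A : zmodType) (T : finType) (g : T -> A) (Z : {set T})
    (f : A -> nat) :
  \sum_(x <- values g Z) f x = \sum_(y in Z) f (g y).
Proof. by rewrite big_map big_enum. Qed.

(** Distinct pairs of a parent and a gap give distinct children ([insert_inj]), so the union
    defining the level is disjoint. *)
Lemma sum_treeS n (M : matching n) l (F : matching (l + n).+1 -> nat) :
  \sum_(N in tree M l.+1) F N =
  \sum_(M' in tree M l) \sum_(i < (l + n).*2.+1) F (insert M' i).
Proof.
have -> : tree M l.+1 =
    [set insert p.1 p.2 | p in setX (tree M l) [set: 'I_(l + n).*2.+1]].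
  apply/setP=> N; apply/bigcupP/imsetP.
    by case=> M' tM' /imsetP[i _ ->]; exists (M', i); rewrite // !inE tM'.
  case=> -[M' i]; rewrite !inE andbT => tM' ->; exists M' => //.
  by apply/imsetP; exists i.
rewrite big_imset /= => [|[M1 i] [M2 j] _ _ /= /insert_inj[-> ->] //].
rewrite pair_big_dep /=; apply: eq_bigl => -[M' i].
by rewrite !inE.
Qed.

(** * Recursion for sums over the levels of the tree *)

Section TreeSums.

Variables (A : zmodType) (alpha beta : A).

Definition relseq m (M : matching m) : seq A :=
  shift (seqstat alpha beta M) (- stat alpha beta M)%R.

Lemma stat_insert_seqstat m (M : matching m) i :
  stat alpha beta (insert M i) = ((seqstat alpha beta M)`_i)%R.
Proof. by rewrite stat_insert nth_seqstat // -ltnS. Qed.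

Lemma size_relseq m (M : matching m) : size (relseq M) = m.*2.+1.
Proof. by rewrite size_map size_seqstat. Qed.

Lemma stat_insert_relseq m (M : matching m) (i : 'I_m.*2.+1) :
  stat alpha beta (insert M i) = (stat alpha beta M + (relseq M)`_i)%R.
Proof.
by rewrite (nth_map 0%R) ?size_seqstat // -stat_insert_seqstat addrC subrK.
Qed.

Lemma relseq_insert m (M : matching m) (i : 'I_m.*2.+1) :
  relseq (insert M i) = rel_child alpha beta i (relseq M).
Proof.
have s0 : ((seqstat alpha beta M)`_0 = stat alpha beta M)%R.
  by rewrite nth_seqstat // ncover0 nleft0 !addr0.
rewrite /relseq stat_insert_seqstat seqstat_insert /Rop /rel_child s0.
rewrite {1}/shift /= subrr map_cat /shift -!map_take -!map_drop -!map_comp.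
set x := nth _ _ _; set y := stat _ _ _.
have alg z c : (z + (x - y + c) - x = z - y + c)%R.
  by rewrite -!addrA; congr (_ + _)%R; rewrite [LHS]addrC -!addrA addNr addr0.
by congr (_ :: _ ++ _); apply: eq_map => z /=; rewrite alg.
Qed.

Definition treesum n (M : matching n) l r (f : A -> nat) : nat :=
  \sum_(M' in tree M l)
     hsum r (relseq M') (fun z => f (stat alpha beta M' + z)%R).

Lemma treesumS n (M : matching n) l r f :
  treesum M l.+1 r f =
  \sum_(t < r.+1) \sum_(a < t.+1)
     treesum M l t.+1 (fun z => f (z + (alpha *+ a + beta *+ (t - a)))%R).
Proof.
rewrite /treesum sum_treeS.
under [RHS]eq_bigr do rewrite exchange_big.
rewrite [RHS]exchange_big; apply: eq_bigr => M' _.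
under [RHS]eq_bigr do under eq_bigr do under eq_hsum do rewrite -addrA.
have := sum_hsum_rel_child alpha beta r (relseq M')
  (fun z => f (stat alpha beta M' + z)%R).
move=> /= <-; rewrite size_relseq; apply: eq_bigr => i _.
by rewrite relseq_insert stat_insert_relseq; apply: eq_hsum => z; rewrite addrA.
Qed.

Lemma treesum_r0 n (M : matching n) l f :
  treesum M l 0 f = \sum_(M' in tree M l) f (stat alpha beta M').
Proof. by apply: eq_bigr => M' _; rewrite /= addr0. Qed.

Lemma sum_seqstat n (M : matching n) f :
  \sum_(x <- seqstat alpha beta M) f x =
  \sum_(M' in tree M 1) f (stat alpha beta M').
Proof.
rewrite sum_treeS big_set1 (big_nth 0%R) big_mkord size_seqstat.
by apply: eq_bigr => i _; rewrite stat_insert_seqstat.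
Qed.

End TreeSums.

(** Replacing [a] by [t - a] exchanges the weights in the shifts. *)
Lemma treesum_swap (A : zmodType) (alpha beta : A) n (M : matching n) l r f :
  treesum alpha beta M l.+1 r f =
  \sum_(t < r.+1) \sum_(a < t.+1)
     treesum alpha beta M l t.+1
       (fun z => f (z + (beta *+ a + alpha *+ (t - a)))%R).
Proof.
rewrite treesumS; apply: eq_bigr => t _.
rewrite (reindex_inj rev_ord_inj) /=; apply: eq_bigr => a _.
apply: eq_bigr => M' _; apply: eq_hsum => z.
by rewrite subSS subKn ?leq_ord // [(alpha *+ _ + _)%R]addrC.
Qed.

(** * Comparing two trees *)

Section TreeComparison.

Variables (A : zmodType) (alpha beta alpha' beta' : A).
Variables (n : nat) (M N : matching n).

Lemma eq_treesum :
    (alpha', beta') = (alpha, beta) \/ (alpha', beta') = (beta, alpha) ->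
    stat alpha beta M = stat alpha' beta' N ->
    perm_eq (seqstat alpha beta M) (seqstat alpha' beta' N) ->
  forall l r f, treesum alpha beta M l r f = treesum alpha' beta' N l r f.
Proof.
move=> same_weights eq_stat eq_seq; elim=> [|l IHl] r f.
  rewrite /treesum !big_set1 eq_stat; apply: perm_hsum.
  by rewrite /relseq eq_stat; apply: perm_map.
case: same_weights => -[def_a def_b].
  rewrite !treesumS; apply: eq_bigr => t _; apply: eq_bigr => a _.
  by rewrite IHl def_a def_b.
rewrite treesumS treesum_swap; apply: eq_bigr => t _; apply: eq_bigr => a _.
by rewrite IHl def_a def_b.
Qed.

Lemma tree_values_eqP :
    (alpha', beta') = (alpha, beta) \/ (alpha', beta') = (beta, alpha) ->
  (forall l : nat,
     perm_eq (values (stat alpha beta (n := l + n)) (tree M l))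
             (values (stat alpha' beta' (n := l + n)) (tree N l)))
  <->
  (stat alpha beta M = stat alpha' beta' N
   /\ perm_eq (seqstat alpha beta M) (seqstat alpha' beta' N)).
Proof.
move=> same_weights; split=> [eq_val | [eq_stat eq_seq] l].
  split; last first.
    apply/perm_eq_sumP => f; rewrite !sum_seqstat -!sum_values.
    exact: perm_big (eq_val 1).
  (* Level 0 is a singleton on each side, so testing with the indicator of [stat alpha beta M]
     forces the two statistics to agree. *)
  have /perm_eq_sumP/(_ (fun x => x == stat alpha beta M : nat)) := eq_val 0.
  by rewrite !sum_values !big_set1 eqxx; case: eqP.
apply/perm_eq_sumP => f.
by rewrite !sum_values -!treesum_r0; apply: eq_treesum.
Qed.

End TreeComparison.

Theorem theorem2p7 (A : zmodType) (alpha beta : A) (n : nat)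
    (M N : matching n) :
  ((forall l : nat,
      perm_eq (values (stat alpha beta (n := l + n)) (tree M l))
              (values (stat alpha beta (n := l + n)) (tree N l)))
   <->
   (stat alpha beta M = stat alpha beta N
    /\ perm_eq (seqstat alpha beta M) (seqstat alpha beta N)))
  /\
  ((forall l : nat,
      perm_eq (values (stat alpha beta (n := l + n)) (tree M l))
              (values (stat beta alpha (n := l + n)) (tree N l)))
   <->
   (stat alpha beta M = stat beta alpha N
    /\ perm_eq (seqstat alpha beta M) (seqstat beta alpha N))).
Proof. by split; apply: tree_values_eqP; [left | right]. Qed.
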